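(* No tournament on $11$ vertices is intrinsically $4$-linked as a directed graph.
   Context: A tournament on $n$ vertices is a directed graph on $n$ vertices with exactly one directed edge between each pair of distinct vertices (equivalently, the complete graph $K_n$ with a choice of orientation of each edge). Embeddings are embeddings of the graph in $S^3$, in the usual (tame) sense of spatial graph theory. A cycle in a directed graph means a cycle of the underlying undirected graph; it is consistently oriented if its edges all point the same way around the cycle (i.e. it is a directed cycle). A directed graph $G$ is intrinsically $n$-linked as a directed graph (digraph) if every embedding of $G$ in $S^3$ contains $n$ pairwise disjoint, consistently oriented cycles that form a non-split $n$-component link. *)

(* Defs.v *)
From HB Require Import structures.
From mathcomp Require Import all_boot all_order all_algebra.
From mathcomp Require Import all_classical all_reals all_analysis.

Set Implicit Arguments.
Unset Strict Implicit.
Unset Printing Implicit Defensive.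

Import Order.TTheory GRing.Theory Num.Theory.
Import numFieldNormedType.Exports.

Local Open Scope classical_set_scope.
Local Open Scope ring_scope.

(* A directed graph on the finite vertex type T is a relation e : rel T, with
   [e x y] meaning that there is an edge from x to y. *)

Definition tournament (T : finType) (e : rel T) : Prop :=
  irreflexive e /\ (forall x y : T, x != y -> e x y (+) e y x).

(* The vertices of c are listed in cyclic order, every edge pointing from a
   vertex to the next one. In an arbitrary digraph, loops and pairs of opposite
   edges are admitted as cycles of length 1 and 2; a tournament has neither. *)
Definition directed_cycle (T : finType) (e : rel T) (c : seq T) : Prop :=
  c <> [::] /\ ucycle e c.

(* Used below as a type, this is a [set_type], hence carries the topology
   induced by 'rV[R]_n.+1. The sum of squares is explicit because the library
   norm on matrices is the sup norm. *)
Definition sphere (R : realType) (n : nat) : set 'rV[R]_n.+1 :=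
  [set x | \sum_(i < n.+1) x ord0 i ^+ 2 = 1].
Arguments sphere R n _ : clear implicits.

Definition cone (R : realType) (m : nat) (s : seq 'rV[R]_m) : set 'rV[R]_m :=
  [set x | exists2 a : 'I_(size s) -> R,
     (forall i, 0 <= a i) & x = \sum_(i < size s) a i *: s`_i].

(* Polyhedra for the standard PL structure of the sphere, obtained by radially
   projecting the boundary of a convex polytope around the origin: they are the
   finite unions of spherical simplices, equivalently of intersections of the
   sphere with finitely generated convex cones. *)
Definition polyhedral (R : realType) (n : nat) (X : set (sphere R n)) : Prop :=
  exists P : seq (seq 'rV[R]_n.+1),
    forall x : sphere R n, X x <-> exists2 s, s \in P & cone s (set_val x).

(* X is carried onto a polyhedron by a self-homeomorphism of the sphere. *)
Definition tame (R : realType) (n : nat) (X : set (sphere R n)) : Prop :=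
  exists h g : sphere R n -> sphere R n,
    [/\ continuous h, continuous g, cancel h g, cancel g h
      & polyhedral (h @` X)].

Definition graph_image (R : realType) (T : finType) (e : rel T)
    (phi : T -> sphere R 3) (gam : T -> T -> R -> sphere R 3) :
    set (sphere R 3) :=
  [set phi x | x in setT] `|`
  \bigcup_(p in [set p : T * T | e p.1 p.2]) (gam p.1 p.2 @` `[0, 1]).

(* Vertices are placed by phi, and the edge from x to y is parametrized by the
   restriction of gam x y to [0, 1] (gam x y is irrelevant if there is no such
   edge). The conditions other than tameness say that the induced map from the
   geometric realization of the graph to S^3 is well defined, continuous and
   injective; as the realization is compact, it is a topological embedding. *)
Record spatial_embedding (R : realType) (T : finType) (e : rel T)
    (phi : T -> sphere R 3) (gam : T -> T -> R -> sphere R 3) : Prop := {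
  embedding_continuous : forall x y, e x y -> {within `[0, 1], continuous (gam x y)};
  embedding_source : forall x y, e x y -> gam x y 0 = phi x;
  embedding_target : forall x y, e x y -> gam x y 1 = phi y;
  embedding_vertices : injective phi;
  embedding_vertex_edge : forall x y z t, e x y -> 0 < t < 1 ->
    gam x y t <> phi z;
  embedding_edges : forall x y x' y' t t', e x y -> e x' y' ->
    0 < t < 1 -> 0 < t' < 1 -> gam x y t = gam x' y' t' ->
    [/\ x = x', y = y' & t = t'];
  embedding_tame : tame (graph_image e phi gam)
}.

Definition cycle_image (R : realType) (T : finType)
    (gam : T -> T -> R -> sphere R 3) (c : seq T) : set (sphere R 3) :=
  \bigcup_(x in [set` c]) (gam x (next c x) @` `[0, 1]).

(* A link with components L i is split if some tame 2-sphere in its complement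
   separates two of its components. *)
Definition split_link (R : realType) (n : nat) (L : 'I_n -> set (sphere R 3)) :
    Prop :=
  exists F : sphere R 2 -> sphere R 3,
    [/\ continuous F, injective F, tame (range F),
        (forall i, L i `&` range F = set0)
      & exists i j, forall x y, L i x -> L j y ->
          ~ connected_component (~` range F) x y].

Definition intrinsically_linked_digraph (R : realType) (n : nat) (T : finType)
    (e : rel T) : Prop :=
  forall (phi : T -> sphere R 3) (gam : T -> T -> R -> sphere R 3),
    spatial_embedding e phi gam ->
    exists c : 'I_n -> seq T,
      [/\ forall i, directed_cycle e (c i),
          forall i j x, i != j -> x \in c i -> x \notin c j
        & ~ split_link (fun i => cycle_image gam (c i))].

(* Main.v *)
Require Import Defs.
From mathcomp Require Import all_boot all_order all_algebra.
From mathcomp Require Import all_classical all_reals all_analysis.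
From mathcomp Require Import ring lra.

(** Four disjoint directed cycles of a tournament use at least 12 vertices, so
    on 11 vertices it suffices to exhibit one spatial embedding. Put the
    vertices on the moment curve (1, t, t^2, t^3) of R^4 and join them by
    straight segments. Any four points of the curve are linearly independent,
    hence the cones over two segments meet only where they must, and the radial
    projection to S^3 is an embedding whose image is already polyhedral. *)

Set Implicit Arguments.
Unset Strict Implicit.
Unset Printing Implicit Defensive.

Import Order.TTheory GRing.Theory Num.Theory.
Import numFieldNormedType.Exports.

Local Open Scope classical_set_scope.
Local Open Scope ring_scope.

(** * Radial projection of nonzero vectors to the unit sphere *)

Section RadialProjection.
Variables (R : realType) (n : nat).
Implicit Types (w : 'rV[R]_n.+1) (x : sphere R n).

Definition sqnorm w : R := \sum_(i < n.+1) w ord0 i ^+ 2.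

Lemma sqnormZ (a : R) w : sqnorm (a *: w) = a ^+ 2 * sqnorm w.
Proof. by rewrite mulr_sumr; apply: eq_bigr => i _; rewrite mxE exprMn. Qed.

Lemma sqnorm_gt0 w (i : 'I_n.+1) : w ord0 i != 0 -> 0 < sqnorm w.
Proof.
move=> wi; rewrite /sqnorm (bigD1 i) //= ltr_wpDr ?exprn_even_gt0 //.
by apply: sumr_ge0 => j _; rewrite sqr_ge0.
Qed.

Lemma sqnorm_sphere x : sqnorm (set_val x) = 1.
Proof. exact: (set_valP x). Qed.

Lemma sphere_inj : injective (fun x => set_val x).
Proof. by move=> x y; rewrite set_valE => /val_inj. Qed.

Lemma radial_subproof w (w_gt0 : 0 < sqnorm w) :
  (Num.sqrt (sqnorm w))^-1 *: w \in sphere R n.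
Proof.
apply: mem_set; rewrite /sphere /= -/(sqnorm _) sqnormZ exprVn.
by rewrite sqr_sqrtr ?ltW // mulVf // gt_eqF.
Qed.

Definition radial w (w_gt0 : 0 < sqnorm w) : sphere R n :=
  SigSub (radial_subproof w_gt0).

Lemma radialE w (w_gt0 : 0 < sqnorm w) :
  set_val (radial w_gt0) = (Num.sqrt (sqnorm w))^-1 *: w.
Proof. by rewrite set_valE. Qed.

Lemma radial_coef_gt0 w : 0 < sqnorm w -> 0 < (Num.sqrt (sqnorm w))^-1.
Proof. by move=> w_gt0; rewrite invr_gt0 sqrtr_gt0. Qed.

(** An open ray from the origin meets the sphere once: [a ^+ 2 * sqnorm w = 1] determines a positive
    [a]. Points of the sphere can thus be identified up to a positive factor. *)
Lemma radial_unique (a : R) w (w_gt0 : 0 < sqnorm w) x :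
  0 < a -> set_val x = a *: w -> radial w_gt0 = x.
Proof.
move=> a_gt0 xE; apply: sphere_inj; rewrite radialE xE; congr (_ *: _).
have : a ^+ 2 * sqnorm w = 1 by rewrite -sqnormZ -xE sqnorm_sphere.
move=> /(congr1 Num.sqrt); rewrite sqrtrM ?sqr_ge0 // sqrtr_sqr sqrtr1.
rewrite gtr0_norm // => aw1; apply: (mulIf (_ : Num.sqrt (sqnorm w) != 0)).
  by rewrite gt_eqF // sqrtr_gt0.
by rewrite aw1 mulVf // gt_eqF // sqrtr_gt0.
Qed.

Lemma sqnorm_continuous : continuous sqnorm.
Proof.
apply: (@continuous_big _ _ +%R) => [|i _ w]; first exact: add_continuous.
apply: (@continuous_comp _ _ _ (fun v : 'rV[R]_n.+1 => v ord0 i)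
  (fun z => z ^+ 2)); last exact: exprn_continuous.
exact: coord_continuous.
Qed.

Lemma radial_continuous (w : R -> 'rV[R]_n.+1)
    (w_gt0 : forall t, 0 < sqnorm (w t)) :
  continuous w -> continuous (fun t => radial (w_gt0 t)).
Proof.
(* The sphere carries the topology induced by [set_val], so continuity is checked in the ambient
   space. *)
move=> wC; apply: (@continuous_comp_initial _ _ _ set_val) => t.
have -> : set_val \o (fun t => radial (w_gt0 t)) =
    (fun t => (Num.sqrt (sqnorm (w t)))^-1 *: w t).
  by apply/funext => s /=; rewrite radialE.
apply: cvgZ; last exact: wC.
apply: cvgV; first by rewrite gt_eqF // sqrtr_gt0.
apply: continuous_comp; last exact: sqrt_continuous.
by apply: continuous_comp; [exact: wC|exact: sqnorm_continuous].
Qed.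

Lemma polyhedral_tame (X : set (sphere R n)) : polyhedral X -> tame X.
Proof.
move=> polX; exists id, id; split=> //; try by move=> x.
by rewrite image_id.
Qed.

End RadialProjection.

(** * Cones on one and two generators *)

Section Cones.
Variables (R : realType) (m : nat).
Implicit Types u v x : 'rV[R]_m.

Lemma cone1P u x : cone [:: u] x <-> exists2 a, 0 <= a & x = a *: u.
Proof.
split=> [[a a_ge0 ->]|[a a_ge0 ->]].
  by exists (a ord0) => //; rewrite big_ord1.
by exists (fun=> a) => //; rewrite big_ord1.
Qed.

Lemma cone2P u v x : cone [:: u; v] x <->
  exists a b, [/\ 0 <= a, 0 <= b & x = a *: u + b *: v].
Proof.
split=> [[a a_ge0 ->]|[a [b [a_ge0 b_ge0 ->]]]].
  exists (a ord0), (a (lift ord0 ord0)); split=> //.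
  by rewrite big_ord_recl big_ord1.
exists (fun i => if i == ord0 then a else b) => [i|]; first by case: ifP.
by rewrite big_ord_recl big_ord1.
Qed.

End Cones.

(** * The moment curve and its chords, projected to the 3-sphere *)

Section MomentCurve.
Variable R : realType.
Implicit Types a b c d t : R.

Definition moment a : 'rV[R]_4 := \row_(i < 4) a ^+ i.

(** Pairing with the coefficient vector of [q], of degree at most 3, is a linear form sending
    [moment a] to [q.[a]]. *)
Lemma moment_horner (q : {poly R}) a b c d (l m r s : R) : (size q <= 4)%N ->
  l *: moment a + m *: moment b = r *: moment c + s *: moment d ->
  l * q.[a] + m * q.[b] = r * q.[c] + s * q.[d].
Proof.
move=> q4 eq_lr; rewrite !(horner_coef_wide _ q4) !mulr_sumr -!big_split /=.
apply: eq_bigr => i _; move/rowP: eq_lr => /(_ i); rewrite !mxE => eq_i.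
by rewrite !(mulrCA _ q`_i) -!mulrDr eq_i.
Qed.

(* Evaluate at the cubic vanishing at [b], [c] and [d]. *)
Lemma moment_mem a b c d (l m r s : R) : l != 0 -> a != b ->
  l *: moment a + m *: moment b = r *: moment c + s *: moment d ->
  a = c \/ a = d.
Proof.
move=> l0 ab; pose q := ('X - b%:P) * ('X - c%:P) * ('X - d%:P).
have q4 : (size q <= 4)%N.
  by rewrite /q !size_mul ?mulf_neq0 ?polyXsubC_eq0 ?size_XsubC.
move=> /(moment_horner q4); rewrite /q !(hornerM, hornerXsubC) !subrr.
rewrite !(mul0r, mulr0, addr0).
move=> /eqP; rewrite !mulf_eq0 (negPf l0) !subr_eq0 (negPf ab) /=.
by case/orP=> /eqP; [left|right].
Qed.

Lemma moment_pair a b c d (l m r s : R) : l != 0 -> m != 0 -> a != b ->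
  l *: moment a + m *: moment b = r *: moment c + s *: moment d ->
  (a = c /\ b = d) \/ (a = d /\ b = c).
Proof.
move=> l0 m0 ab eq_lr.
(* [moment_mem] locates [a] and then, with the summands swapped, [b]; distinctness rules out that
   both match the same point. *)
have [] := moment_mem l0 ab eq_lr; rewrite eq_sym addrC in ab eq_lr.
all: have [] := moment_mem m0 ab eq_lr => bE aE; rewrite ?aE ?bE ?eqxx // in ab *.
all: by auto.
Qed.

(** Evaluation at ['X - a%:P] and at ['X - b%:P] each kills one term and isolates one
    coefficient. *)
Lemma moment_coef a b (l m r s : R) : a != b ->
  l *: moment a + m *: moment b = r *: moment a + s *: moment b ->
  l = r /\ m = s.
Proof.
move=> ab eq_lr; have q4 c : (size ('X - c%:P)%R <= 4)%N by rewrite size_XsubC.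
have := moment_horner (q4 a) eq_lr; have := moment_horner (q4 b) eq_lr.
have ab0 : a - b != 0 by rewrite subr_eq0.
have ba0 : b - a != 0 by rewrite subr_eq0 eq_sym.
rewrite !hornerXsubC !subrr !mulr0 !addr0 !add0r.
by move=> /(mulIf ab0) ? /(mulIf ba0).
Qed.

Definition chord a b t : 'rV[R]_4 := (1 - t) *: moment a + t *: moment b.

Lemma sqnorm_moment_gt0 a : 0 < sqnorm (moment a).
Proof. by apply: (@sqnorm_gt0 _ _ _ ord0); rewrite mxE expr0 oner_eq0. Qed.

(** The coordinate of index 0 is 1 on the whole affine line through two points of the curve. This
    line misses the origin, so its projection is defined for every real [t]. *)
Lemma sqnorm_chord_gt0 a b t : 0 < sqnorm (chord a b t).
Proof.
apply: (@sqnorm_gt0 _ _ _ ord0).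
by rewrite !mxE !expr0 !mulr1 subrK oner_eq0.
Qed.

Definition moment_sphere a : sphere R 3 := radial (sqnorm_moment_gt0 a).

Definition chord_sphere a b t : sphere R 3 := radial (sqnorm_chord_gt0 a b t).

Lemma chord_sphere_continuous a b : continuous (chord_sphere a b).
Proof.
apply: radial_continuous => t; apply: cvgD; apply: cvgZ; try exact: cvg_cst.
  by apply: cvgB; [exact: cvg_cst|exact: cvg_id].
exact: cvg_id.
Qed.

Lemma chord_sphere_source a b : chord_sphere a b 0 = moment_sphere a.
Proof.
apply: (@radial_unique _ _ (Num.sqrt (sqnorm (moment a)))^-1).
  exact/radial_coef_gt0/sqnorm_moment_gt0.
by rewrite radialE /chord subr0 scale1r scale0r addr0.
Qed.

Lemma chord_sphere_target a b : chord_sphere a b 1 = moment_sphere b.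
Proof.
apply: (@radial_unique _ _ (Num.sqrt (sqnorm (moment b)))^-1).
  exact/radial_coef_gt0/sqnorm_moment_gt0.
by rewrite radialE /chord subrr scale1r scale0r add0r.
Qed.

Lemma moment_sphere_inj : injective moment_sphere.
Proof.
move=> a b /(congr1 (fun x : sphere R 3 => set_val x)); rewrite !radialE.
have := radial_coef_gt0 (sqnorm_moment_gt0 a).
set l := (Num.sqrt (sqnorm (moment a)))^-1.
set r := (Num.sqrt (sqnorm (moment b)))^-1 => l_gt0 eq_lr.
apply: contrapT => /eqP ab.
(* Padding with zero multiples of [moment b] gives the form of [moment_mem], whose two alternatives
   then both read [a = b]. *)
have eq_lr0 : l *: moment a + 0 *: moment b = r *: moment b + 0 *: moment b.
  by rewrite !scale0r !addr0.
by have [] := moment_mem (lt0r_neq0 l_gt0) ab eq_lr0; move/eqP: ab.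
Qed.

(** The ratio [m / (l + m)] is unaffected by the normalizing factor, so the parameter can be
    recovered from the projected point. *)
Lemma chord_sphereE a b t : 0 < t < 1 -> exists l m : R,
  [/\ 0 < l, 0 < m, t = m / (l + m) &
   set_val (chord_sphere a b t) = l *: moment a + m *: moment b].
Proof.
move=> /andP[t_gt0 t_lt1]; rewrite radialE.
have := radial_coef_gt0 (sqnorm_chord_gt0 a b t).
move: (Num.sqrt _)^-1 => k k_gt0; exists (k * (1 - t)), (k * t).
split; rewrite ?mulr_gt0 ?subr_gt0 //; last by rewrite scalerDr !scalerA.
by field; lra.
Qed.

Lemma chord_sphere_neq_moment a b c t : a != b -> 0 < t < 1 ->
  chord_sphere a b t <> moment_sphere c.
Proof.
move=> ab /(chord_sphereE a b)[l [m [l_gt0 m_gt0 _ eq_lm]]].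
move=> /(congr1 (fun x : sphere R 3 => set_val x)).
(* The added zero term repeats [c], so [moment_pair] makes both [a] and [b] equal to [c]. *)
rewrite eq_lm radialE -[RHS]addr0 -(scale0r (moment c)).
move=> /(moment_pair (lt0r_neq0 l_gt0) (lt0r_neq0 m_gt0) ab).
by case=> -[ac bc]; rewrite ac bc eqxx in ab.
Qed.

(** Two interior points can only coincide on the same chord; the second alternative is that chord
    traversed backwards. *)
Lemma chord_sphere_meet a b c d t t' : a != b -> 0 < t < 1 -> 0 < t' < 1 ->
  chord_sphere a b t = chord_sphere c d t' ->
  [/\ a = c, b = d & t = t'] \/ (a = d /\ b = c).
Proof.
move=> ab /(chord_sphereE a b)[l [m [l_gt0 m_gt0 -> eq_lm]]].
move=> /(chord_sphereE c d)[r [s [r_gt0 s_gt0 -> eq_rs]]].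
move=> /(congr1 (fun x : sphere R 3 => set_val x)); rewrite eq_lm eq_rs => eq_lr.
have [[ac bd]|] := moment_pair (lt0r_neq0 l_gt0) (lt0r_neq0 m_gt0) ab eq_lr.
  left; subst c d; split=> //.
  by have [-> ->] := moment_coef ab eq_lr.
by right.
Qed.

Lemma cone_moment a (x : sphere R 3) :
  cone [:: moment a] (set_val x) <-> x = moment_sphere a.
Proof.
split=> [/cone1P[l l_ge0 xE]|->]; last first.
  apply/cone1P; exists (Num.sqrt (sqnorm (moment a)))^-1; last exact: radialE.
  exact/ltW/radial_coef_gt0/sqnorm_moment_gt0.
apply/esym/(radial_unique _ _ xE); rewrite lt_neqAle l_ge0 andbT eq_sym.
apply/eqP => l0; have /eqP := sqnorm_sphere x.
by rewrite xE l0 sqnormZ expr0n mul0r eq_sym oner_eq0.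
Qed.

(** With [cone_moment], this matches vertices and edges with the cones required by [polyhedral]. *)
Lemma cone_chord a b (x : sphere R 3) :
  cone [:: moment a; moment b] (set_val x) <->
  (chord_sphere a b @` `[0, 1]) x.
Proof.
split=> [/cone2P[l [m [l_ge0 m_ge0 xE]]]|[t /=]]; last first.
  rewrite in_itv /= => /andP[t_ge0 t_le1] <-; apply/cone2P.
  have := radial_coef_gt0 (sqnorm_chord_gt0 a b t); rewrite radialE.
  move: (Num.sqrt _)^-1 => k k_gt0; exists (k * (1 - t)), (k * t).
  split; rewrite ?mulr_ge0 ?subr_ge0 ?(ltW k_gt0) //.
  by rewrite scalerDr !scalerA.
(* If both coefficients vanished, [x] would be the origin, which is not on the sphere. *)
have lm_gt0 : 0 < l + m.
  rewrite lt_neqAle addr_ge0 // andbT eq_sym paddr_eq0 //.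
  apply/negP => /andP[/eqP l0 /eqP m0]; have /eqP := sqnorm_sphere x.
  rewrite xE l0 m0 !scale0r addr0 -(scale0r 0) sqnormZ.
  by rewrite expr0n mul0r eq_sym oner_eq0.
have lm0 := lt0r_neq0 lm_gt0.
(* Division by [l + m] makes the coefficients sum to 1, which lands on the chord. *)
exists (m / (l + m)).
  rewrite /= in_itv /= divr_ge0 ?addr_ge0 //= ler_pdivrMr // mul1r.
  by rewrite lerDr.
apply: (radial_unique _ lm_gt0); rewrite xE scalerDr !scalerA.
by congr (_ *: _ + _ *: _); field.
Qed.

End MomentCurve.

(** * A straight-line embedding of any digraph without loops or opposite edges *)

Lemma exists_spatial_embedding (R : realType) (T : finType) (e : rel T) :
  irreflexive e -> (forall x y, e x y -> ~~ e y x) ->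
  exists (phi : T -> sphere R 3) (gam : T -> T -> R -> sphere R 3),
    spatial_embedding e phi gam.
Proof.
(* Ranks in the enumeration of [T] serve as distinct real parameters on the curve. *)
move=> e_irr e_asym; pose p (x : T) : R := (enum_rank x)%:R.
have p_inj : injective p.
  by move=> x y /eqP; rewrite eqr_nat => /eqP/val_inj/enum_rank_inj.
have p_neq x y : e x y -> p x != p y.
  by move=> exy; apply/eqP => /p_inj xy; rewrite xy e_irr in exy.
exists (fun x => moment_sphere (p x)), (fun x y => chord_sphere (p x) (p y)).
split.
- by move=> x y _; apply/continuous_subspaceT/chord_sphere_continuous.
- by move=> x y _; exact: chord_sphere_source.
- by move=> x y _; exact: chord_sphere_target.
- by move=> x y /moment_sphere_inj/p_inj.
- by move=> x y z t /p_neq; exact: chord_sphere_neq_moment.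
- move=> x y x' y' t t' exy exy' t01 t01'.
  move=> /(chord_sphere_meet (p_neq _ _ exy) t01 t01').
  case=> [[/p_inj xx' /p_inj yy' tt']//|[/p_inj xy' /p_inj yx']].
  (* Here the two edges are opposite to each other, against asymmetry. *)
  by have := e_asym _ _ exy; rewrite xy' yx' exy'.
(* The image is a finite union of spherical points and arcs: one ray per vertex and one planar cone
   per edge. *)
apply: polyhedral_tame.
exists ([seq [:: moment (p x)] | x <- enum T] ++
  [seq [:: moment (p u.1); moment (p u.2)] | u <- enum [pred u : T * T | e u.1 u.2]]).
move=> x; split.
  case=> [[y _ <-]|[u /= eu]].
    exists [:: moment (p y)]; last exact/cone_moment.
    by rewrite mem_cat map_f ?mem_enum.
  move=> /cone_chord; exists [:: moment (p u.1); moment (p u.2)] => //.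
  by rewrite mem_cat; apply/orP; right; apply/map_f; rewrite mem_enum.
case=> s; rewrite mem_cat => /orP[|] /mapP[u uP ->].
  by move=> /cone_moment ->; left; exists u.
by move=> /cone_chord; right; exists u => //=; rewrite mem_enum in uP.
Qed.

(** * Counting the vertices of disjoint directed cycles *)

Lemma tournament_asym (T : finType) (e : rel T) : tournament e ->
  forall x y, e x y -> ~~ e y x.
Proof.
move=> [e_irr e_tour] x y exy.
have xy : x != y by apply/eqP => xy; rewrite xy e_irr in exy.
by have := e_tour _ _ xy; rewrite exy.
Qed.

(** A shorter cycle would be a loop or a pair of opposite edges. *)
Lemma tournament_cycle_size (T : finType) (e : rel T) (c : seq T) :
  tournament e -> directed_cycle e c -> (3 <= #|c|)%N.
Proof.
move=> tour [c0 /andP[]]; have [e_irr _] := tour.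
move=> c_cyc /card_uniqP ->.
case: c c0 c_cyc => [|x [|y [|z c]]] //= _; first by rewrite e_irr.
by move=> /and3P[/(tournament_asym tour)/negPf ->].
Qed.

(** Double counting of pairs of an index and a vertex on its cycle: each index gives at least 3
    pairs, each vertex at most one. *)
Lemma disjoint_cycles_card (T : finType) (e : rel T) (n : nat)
    (c : 'I_n -> seq T) : tournament e -> (forall i, directed_cycle e (c i)) ->
  (forall i j x, i != j -> x \in c i -> x \notin c j) -> (n * 3 <= #|T|)%N.
Proof.
move=> tour cyc disj.
have -> : (n * 3 = \sum_(i < n) 3)%N by rewrite sum_nat_const card_ord.
apply: (@leq_trans (\sum_(i < n) #|c i|)%N).
  by apply: leq_sum => i _; exact: tournament_cycle_size (cyc i).
under eq_bigr do rewrite -sum1_card big_mkcond /=.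
rewrite exchange_big /= -sum1_card; apply: leq_sum => x _.
have [i xi|xN] := pickP (fun i => x \in c i).
  rewrite (bigD1 i) //= xi big1 // => j ji.
  by rewrite (negPf (disj i j x _ xi)) // eq_sym.
by rewrite big1 // => i _; rewrite xN.
Qed.

Local Close Scope ring_scope.
Local Close Scope classical_set_scope.

Theorem proposition5p1 (R : realType) (T : finType) (e : rel T) :
  tournament e -> #|T| = 11 -> ~ intrinsically_linked_digraph R 4 e.
Proof.
move=> tour T11 linked.
have [phi [gam emb]] :=
  exists_spatial_embedding R (proj1 tour) (tournament_asym tour).
have [c [cyc disj _]] := linked phi gam emb.
by have := disjoint_cycles_card tour cyc disj; rewrite T11.
Qed.
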